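(* Let $r\geq 2$ and $n\geq r$ be integers and let $G$ be a $K_{r+1}$-free graph of order $n$. (i) If $0\leq\alpha<1-1/r$, then $\lambda(A_\alpha(G))<\lambda(A_\alpha(T_r(n)))$, unless $G=T_r(n)$. (ii) If $1>\alpha>1-1/r$, then $\lambda(A_\alpha(G))<\lambda(A_\alpha(S_{n,r-1}))$, unless $G=S_{n,r-1}$. (iii) If $\alpha=1-1/r$, then $\lambda(A_\alpha(G))\leq(1-1/r)n$, with equality if and only if $G$ is a complete $r$-partite graph.
   Context: Graphs are finite, simple and undirected; equality of graphs means isomorphism. For a graph $G$ with adjacency matrix $A(G)$ and diagonal degree matrix $D(G)$, and $0\leq\alpha\leq 1$, set $A_\alpha(G):=\alpha D(G)+(1-\alpha)A(G)$. For a real symmetric matrix $M$, $\lambda(M)$ is its largest eigenvalue. $K_s$ is the complete graph on $s$ vertices; a graph is $K_s$-free if it contains no complete subgraph on $s$ vertices. A complete $r$-partite graph is one whose vertex set is partitioned into $r$ nonempty edgeless sets with all edges between different sets present. $T_r(n)$ is the $r$-partite Turán graph of order $n$, i.e. the complete $r$-partite graph of order $n$ whose partition sets have sizes $\lfloor n/r\rfloor$ or $\lceil n/r\rceil$. $S_{n,k}$ is the graph of order $n$ obtained by joining every vertex of a complete graph $K_k$ to every vertex of an independent set of $n-k$ vertices. *)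

(* Defs.v *)
(* classical_sets comes before all_boot so that partition, set0 and the set    *)
(* comprehensions are those of finset.                                        *)
From mathcomp Require Import classical_sets reals.
From mathcomp Require Import all_boot all_order all_algebra.
From mathcomp Require Import fingroup perm.
From mathcomp Require Import zify.

Set Implicit Arguments.
Unset Strict Implicit.
Unset Printing Implicit Defensive.

Import Order.TTheory GRing.Theory Num.Theory.
Local Open Scope ring_scope.

(* A graph of order n has vertex set 'I_n; equality of graphs is read as the   *)
(* isomorphism relation [giso].                                               *)
Record sgraph (n : nat) := SGraph {
  adj :> rel 'I_n;
  adj_sym : symmetric adj;
  adj_irrefl : irreflexive adj }.

Definition giso (n : nat) (G H : sgraph n) : Prop :=
  exists s : 'S_n, forall x y : 'I_n, G x y = H (s x) (s y).

Definition clique_free (n s : nat) (G : sgraph n) : Prop :=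
  ~ exists A : {set 'I_n},
      #|A| = s /\ {in A &, forall x y, x != y -> G x y}.

Definition degree (n : nat) (G : sgraph n) (x : 'I_n) : nat :=
  #|[set y | G x y]|.

(* The blocks of a [partition] are nonempty. *)
Definition complete_partite_on (n : nat) (G : sgraph n)
    (P : {set {set 'I_n}}) : Prop :=
  [/\ partition P [set: 'I_n],
      forall B, B \in P -> {in B &, forall x y, ~~ G x y} &
      forall B C, B \in P -> C \in P -> B != C ->
        forall x y, x \in B -> y \in C -> G x y].

Definition complete_partite (n r : nat) (G : sgraph n) : Prop :=
  exists P : {set {set 'I_n}}, #|P| = r /\ complete_partite_on G P.

Section Models.
Variables n k : nat.

Definition turan_rel : rel 'I_n := fun x y => (x %% k != y %% k)%N.

Lemma turan_sym : symmetric turan_rel.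
Proof. by move=> x y; rewrite /turan_rel eq_sym. Qed.

Lemma turan_irrefl : irreflexive turan_rel.
Proof. by move=> x; rewrite /turan_rel eqxx. Qed.

Definition split_rel : rel 'I_n :=
  fun x y => (x != y) && ((x < k)%N || (y < k)%N).

Lemma split_sym : symmetric split_rel.
Proof. by move=> x y; rewrite /split_rel eq_sym orbC. Qed.

Lemma split_irrefl : irreflexive split_rel.
Proof. by move=> x; rewrite /split_rel eqxx. Qed.

End Models.

(* T_r(n), with the residue classes mod r as partition sets; [turanP] checks   *)
(* that this is the balanced complete r-partite graph.                        *)
Definition turan (r n : nat) : sgraph n :=
  SGraph (@turan_sym n r) (@turan_irrefl n r).

(* S_{n,k}, with the vertices 0, ..., k-1 spanning the complete graph K_k and  *)
(* the remaining ones the independent set.                                    *)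
Definition split_graph (n k : nat) : sgraph n :=
  SGraph (@split_sym n k) (@split_irrefl n k).

Lemma card_residue (r n c : nat) : (c < r)%N ->
  #|[set x : 'I_n | (x %% r == c)%N]| = ((n + (r.-1 - c)) %/ r)%N.
Proof.
move=> cr; have r0 : (0 < r)%N by apply: leq_ltn_trans cr.
rewrite -sum1dep_card big_mkcond /=.
elim: n => [|n IHn]; first by rewrite big_ord0 add0n divn_small //; lia.
rewrite big_ord_recr /= IHn addSn divnS // addnC; congr (_ + _)%N.
have -> : (n + (r.-1 - c)).+1 = (n + (r - c))%N by lia.
suff -> : (r %| n + (r - c))%N = (n %% r == c)%N by case: eqP.
rewrite -[in RHS](modn_small cr) -(eqn_modDr (r - c)) subnKC 1?ltnW //.
by rewrite modnn.
Qed.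

(* The second size is the ceiling of n / r. *)
Lemma turanP (r n : nat) : (0 < r <= n)%N ->
  exists P : {set {set 'I_n}},
    [/\ #|P| = r, complete_partite_on (turan r n) P &
        forall B, B \in P ->
          #|B| = (n %/ r)%N \/ #|B| = ((n + r.-1) %/ r)%N].
Proof.
move=> /andP[r0 rn].
pose cl (c : 'I_r) := [set x : 'I_n | (x %% r == c)%N].
have clP (c : 'I_r) : exists x, x \in cl c.
  by exists (widen_ord rn c); rewrite inE /= modn_small.
have cl_inj : injective cl.
  move=> c d cd; have [x xc] := clP c.
  have := xc; rewrite cd !inE => /eqP xd; move: xc; rewrite inE => /eqP xc.
  by apply: val_inj; rewrite /= -xc -xd.
exists [set cl c | c : 'I_r]; split.
- by rewrite card_imset // card_ord.
- split.
  + apply/and3P; split.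
    * apply/eqP/setP => x; rewrite inE; apply/bigcupP.
      exists (cl (Ordinal (ltn_pmod x r0))); first exact: imset_f.
      by rewrite inE.
    * apply/trivIsetP => _ _ /imsetP[c _ ->] /imsetP[d _ ->] cd.
      rewrite -setI_eq0; apply/eqP/setP => x; rewrite !inE.
      apply/negP => /andP[/eqP xc /eqP xd]; case/eqP: cd; congr cl.
      by apply: val_inj; rewrite /= -xc -xd.
    * apply/imsetP => -[c _ c0]; have [x] := clP c.
      by rewrite -c0 inE.
  + move=> _ /imsetP[c _ ->] x y; rewrite !inE => /eqP xc /eqP yc.
    by rewrite /= /turan_rel xc yc eqxx.
  + move=> _ _ /imsetP[c _ ->] /imsetP[d _ ->] cd x y.
    rewrite !inE => /eqP xc /eqP yd; rewrite /= /turan_rel xc yd.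
    by apply: contra_neq cd => cd; congr cl; apply: val_inj.
- move=> _ /imsetP[c _ ->]; rewrite card_residue //.
  have cr := ltn_ord c.
  have h1 : ((n + (r.-1 - c)) %/ r <= (n + r.-1) %/ r)%N by apply: leq_div2r; lia.
  have h2 : (n %/ r <= (n + (r.-1 - c)) %/ r)%N by apply: leq_div2r; lia.
  have h3 : ((n + r.-1) %/ r <= (n %/ r).+1)%N.
    have <- : ((n + r) %/ r)%N = (n %/ r).+1 by rewrite divnDr // divnn r0 addn1.
    by apply: leq_div2r; lia.
  lia.
Qed.

Section Matrices.
Variables (R : realType) (n : nat).

Definition adj_mx (G : sgraph n) : 'M[R]_n :=
  \matrix_(i, j) (G i j : nat)%:R.

Definition deg_mx (G : sgraph n) : 'M[R]_n :=
  diag_mx (\row_i (degree G i)%:R).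

Definition alpha_mx (alpha : R) (G : sgraph n) : 'M[R]_n :=
  alpha *: deg_mx G + (1 - alpha) *: adj_mx G.

(* A matrix has finitely many eigenvalues, and a symmetric one of positive    *)
(* order has a real one, so there the supremum is the largest eigenvalue.     *)
Definition lambda (M : 'M[R]_n) : R := sup [set a : R | eigenvalue M a]%classic.

End Matrices.

(* Main.v *)
(* Let x >= 0 be a Perron vector of A_alpha(G), with support W, and let *)
(* lambda' = alpha n + mu be the conjectured maximum. As in Erdos's proof of *)
(* Turan's theorem, the non-neighbours in W of a vertex of maximal marginal *)
(* weight are replaced by clones of a best one among them, and one recurses *)
(* into the neighbourhood. This shows that <(A_alpha(G) - lambda') x, x> is at *)
(* most the value of the same form on a complete k-partite graph, k <= r, with *)
(* part sizes n_i, equality forcing G[W] to be that graph. By Cauchy-Schwarz *)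
(* the latter value is <= 0 as soon as sum n_i / (mu + n_i) <= 1 / (1 - alpha), *)
(* where equality holds for the eigenvalue of a complete partite graph with *)
(* parts n_i. It remains to maximize sum n_i / (mu + n_i) under sum n_i = n: *)
(* t / (mu + t) is concave if mu > 0 (balanced parts win), convex if mu < 0 *)
(* (one large part wins) and constant if mu = 0, and mu has the sign of *)
(* 1 - 1/r - alpha. *)
From mathcomp Require Import boolp classical_sets reals topology normedtype.
From mathcomp Require Import derive.
Require Import Defs.
From mathcomp Require Import all_boot all_order all_algebra.
From mathcomp Require Import fingroup perm.
From mathcomp Require Import ring lra zify.

Set Implicit Arguments.
Unset Strict Implicit.
Unset Printing Implicit Defensive.

Import Order.TTheory GRing.Theory Num.Theory.
Local Open Scope ring_scope.

(** * Perron vectors *)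

(** The largest eigenvalue maximizes the Rayleigh quotient and, off-diagonal entries being
    nonnegative, has a nonnegative eigenvector ([perron]). Suppose [lambda] of G is at least L =
    alpha n + mu, and let x be that vector, with support W. Then <(A_alpha(G) - L) x, x> is
    nonnegative. [symmetrization] bounds it by the same form on a complete partite graph, and
    [blowup_form_le0] bounds the latter by 0 under the condition on [hsum]; [hsum_deficit] covers
    the case where W is not the whole vertex set. All these inequalities are then tight, and
    [extremal_partite] reads off that G is complete partite with critical part sizes.

    What remains is a one-variable optimization. [partite_lambda] gives the equation satisfied by mu
    for a complete partite graph, [sign_mu] the sign of mu, and [hsum_chord] compares the concave or
    convex summands with a chord. [coloring_iso] turns equal part sizes into an isomorphism. *)

Section Perron.
Variables (R : realType) (n : nat) (M : 'M[R]_n).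
Hypotheses (n_gt0 : (0 < n)%N) (M_sym : forall i j, M i j = M j i).

Definition bform (x y : 'rV[R]_n) : R := \sum_i \sum_j x 0 i * M i j * y 0 j.
Definition nsq (x : 'rV[R]_n) : R := \sum_i x 0 i ^+ 2.

Lemma nsq_ge0 (x : 'rV[R]_n) : 0 <= nsq x.
Proof. by apply: sumr_ge0 => i _; apply: sqr_ge0. Qed.

Lemma nsq_eq0 (x : 'rV[R]_n) : (nsq x == 0) = (x == 0).
Proof.
apply/eqP/eqP => [|->]; last first.
  by rewrite /nsq big1 // => i _; rewrite mxE expr0n.
move=> /eqP; rewrite psumr_eq0 => [/allP x0|i _]; last exact: sqr_ge0.
apply/rowP => i; rewrite mxE; apply/eqP.
by have := x0 i (mem_index_enum _); rewrite sqrf_eq0.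
Qed.

Lemma coord_le_nsq (x : 'rV[R]_n) i : x 0 i ^+ 2 <= nsq x.
Proof.
by rewrite /nsq (bigD1 i) //= lerDl sumr_ge0 // => j _; apply: sqr_ge0.
Qed.

Import numFieldNormedType.Exports.

Lemma continuous_sum (I : Type) (s : seq I) (f : I -> 'rV[R]_n -> R) :
  (forall i, continuous (f i)) -> continuous (fun x => \sum_(i <- s) f i x).
Proof.
move=> fc; elim: s => [|i s IHs] x.
  have -> : (fun y => \sum_(i <- [::]) f i y) = (fun=> 0).
    by apply/funext => y; rewrite big_nil.
  by apply: cst_continuous.
have -> : (fun y => \sum_(j <- i :: s) f j y) =
    (fun y => f i y + \sum_(j <- s) f j y).
  by apply/funext => y; rewrite big_cons.
exact: cvgD (fc i x) (IHs x).
Qed.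

Lemma continuous_bform : continuous (fun x => bform x x).
Proof.
apply: continuous_sum => i; apply: continuous_sum => j x.
have xi := @coord_continuous R 1 n 0 i x.
have xj := @coord_continuous R 1 n 0 j x.
exact: cvgM (cvgM xi (cvg_cst _)) xj.
Qed.

Lemma continuous_nsq : continuous nsq.
Proof.
apply: continuous_sum => i x.
have xi := @coord_continuous R 1 n 0 i x.
exact: (cvgM xi xi).
Qed.

Lemma sphere_compact : compact [set x | nsq x = 1]%classic.
Proof.
apply: bounded_closed_compact; last first.
  apply: (@closed_comp _ _ nsq [set 1]%classic).
    by move=> x _; apply: continuous_nsq.
  exact: closed_eq.
exists 1; split; first exact: real1.
move=> m m1 x /= x1.
have m0 : 0 <= m by apply: le_trans (ltW m1).
rewrite /Num.norm /= mx_normrE; apply/bigmax_leP; split => // -[i j] _ /=.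
rewrite (ord1 i); apply: le_trans (ltW m1).
by rewrite -(@ler_pXn2r _ 2) ?nnegrE // real_normK ?num_real // expr1n -x1
  coord_le_nsq.
Qed.

Lemma quad_max : exists2 x, nsq x = 1 &
  forall y, nsq y = 1 -> bform y y <= bform x x.
Proof.
have nz : ([set x | nsq x = 1] !=set0)%classic.
  exists (delta_mx 0 (Ordinal n_gt0)) => /=.
  rewrite /nsq (bigD1 (Ordinal n_gt0)) //= big1 ?mxE ?eqxx ?expr1n ?addr0 //.
  by move=> i /negbTE i0; rewrite mxE i0 andbF expr0n.
have cq : ({within [set x | nsq x = 1], continuous (fun x => bform x x)})%classic.
  by apply: continuous_subspaceT; apply: continuous_bform.
have [x x1 xmax] := EVT_max_rV nz sphere_compact cq.
by exists x => [|y y1]; [exact: set_mem x1|apply: xmax; apply: mem_set].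
Qed.

Lemma bformZ a x : bform (a *: x) (a *: x) = a ^+ 2 * bform x x.
Proof.
rewrite /bform mulr_sumr; apply: eq_bigr => i _; rewrite mulr_sumr.
by apply: eq_bigr => j _; rewrite !mxE; ring.
Qed.

Lemma nsqZ a x : nsq (a *: x) = a ^+ 2 * nsq x.
Proof.
by rewrite /nsq mulr_sumr; apply: eq_bigr => i _; rewrite !mxE; ring.
Qed.

Lemma bform_max (L : R) : (forall y, nsq y = 1 -> bform y y <= L) ->
  forall y, bform y y <= L * nsq y.
Proof.
move=> maxL y; have [->|y0] := eqVneq y 0.
  have := bformZ 0 0; have := nsqZ 0 0.
  by rewrite scale0r expr0n !mul0r => -> ->; rewrite mulr0.
have ny : 0 < nsq y by rewrite lt0r nsq_ge0 nsq_eq0 y0.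
have := maxL ((Num.sqrt (nsq y))^-1 *: y).
rewrite nsqZ bformZ exprVn (sqr_sqrtr (ltW ny)) mulVf ?gt_eqF // => /(_ erefl).
by rewrite mulrC ler_pdivrMr.
Qed.

Lemma bform_mulmx (x y : 'rV[R]_n) : bform x y = \sum_j (x *m M) 0 j * y 0 j.
Proof.
rewrite /bform exchange_big; apply: eq_bigr => j _ /=.
by rewrite mxE mulr_suml.
Qed.

Lemma bform_addZ x y t :
  bform (x + t *: y) (x + t *: y)
  = bform x x + t *+ 2 * bform x y + t ^+ 2 * bform y y.
Proof.
have xyC : bform x y = bform y x.
  rewrite /bform exchange_big; apply: eq_bigr => i _; apply: eq_bigr => j _.
  by rewrite M_sym; ring.
rewrite mulr2n mulrDl {2}xyC /bform !mulr_sumr -!big_split; apply: eq_bigr => i _ /=.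
rewrite !mulr_sumr -!big_split; apply: eq_bigr => j _ /=.
by rewrite !mxE; ring.
Qed.

Lemma nsq_addZ (x y : 'rV[R]_n) t :
  nsq (x + t *: y)
  = nsq x + t *+ 2 * (\sum_i x 0 i * y 0 i) + t ^+ 2 * nsq y.
Proof.
rewrite /nsq !mulr_sumr -!big_split; apply: eq_bigr => i _ /=.
by rewrite !mxE; ring.
Qed.

(** If A were positive, the linear term would beat the quadratic one at a small t; [A / (|C| + 1)]
    is small enough whatever the sign of C. *)
Lemma tangent_le0 (A C : R) : (forall t, t *+ 2 * A <= t ^+ 2 * C) -> A <= 0.
Proof.
move=> AC; rewrite leNgt; apply/negP => A0.
have C1 : 0 < `|C| + 1 by apply: ltr_wpDl.
have := AC (A / (`|C| + 1)).
have -> : (A / (`|C| + 1)) *+ 2 * A = A ^+ 2 / (`|C| + 1) ^+ 2 * ((`|C| + 1) *+ 2).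
  by field; rewrite gt_eqF.
rewrite expr_div_n ler_pM2l ?divr_gt0 ?exprn_gt0 //.
by have := ler_norm C; lra.
Qed.

(** The residual [z] is half the gradient of [bform - L nsq] at [x]; were it nonzero, a small move
    along it would exceed the bound L. *)
Lemma maximizer_eigen (L : R) x : (forall y, bform y y <= L * nsq y) ->
  bform x x = L * nsq x -> x *m M = L *: x.
Proof.
move=> maxL xL; apply/eqP; rewrite -subr_eq0 -nsq_eq0 eq_le nsq_ge0 andbT.
set z := x *m M - L *: x.
have zE : nsq z = bform x z - L * \sum_i x 0 i * z 0 i.
  rewrite bform_mulmx mulr_sumr -sumrB; apply: eq_bigr => i _.
  by rewrite expr2 {1}/z !mxE; ring.
apply: (@tangent_le0 _ (L * nsq z - bform z z)) => t.
by have := maxL (x + t *: z); rewrite bform_addZ nsq_addZ zE xL; lra.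
Qed.

Hypothesis M_offdiag : forall i j, i != j -> 0 <= M i j.

(** Taking absolute values in a maximizer does not lower the form: diagonal terms do not change, and
    the others can only grow. *)
Lemma perron : exists x : 'rV[R]_n,
  [/\ x != 0, forall i, 0 <= x 0 i & x *m M = lambda M *: x].
Proof.
have [x x1 xmax] := quad_max.
pose y : 'rV[R]_n := \row_i `|x 0 i|; set L := bform x x in xmax.
have maxL := bform_max xmax.
have y1 : nsq y = 1.
  by rewrite -x1; apply: eq_bigr => i _; rewrite mxE real_normK ?num_real.
have yL : bform y y = L * nsq y.
  apply/eqP; rewrite eq_le maxL y1 mulr1 /=.
  apply: ler_sum => i _; apply: ler_sum => j _; rewrite !mxE.
  have [->|ij] := eqVneq i j.
    rewrite mulrAC [X in _ <= X]mulrAC -normrM ger0_norm // -expr2.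
    exact: sqr_ge0.
  rewrite mulrAC [X in _ <= X]mulrAC -normrM.
  by rewrite ler_wpM2r ?M_offdiag ?ler_norm.
have y0 : y != 0 by rewrite -nsq_eq0 y1 oner_neq0.
exists y; split=> // [i|]; first by rewrite mxE.
have eigL := maximizer_eigen maxL yL.
(* Every eigenvalue is the Rayleigh quotient of its eigenvector. *)
have ubL : ubound [set a : R | eigenvalue M a]%classic L.
  move=> a /= /eigenvalueP[v va v0].
  have : 0 < nsq v by rewrite lt0r nsq_ge0 nsq_eq0 v0.
  suff : a * nsq v = bform v v.
    by move=> av v_gt0; rewrite -(ler_pM2r v_gt0) av.
  rewrite bform_mulmx va mulr_sumr; apply: eq_bigr => i _.
  by rewrite mxE; ring.
have eL : [set a : R | eigenvalue M a]%classic L by apply/eigenvalueP; exists y.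
suff -> : lambda M = L by [].
apply/eqP; rewrite eq_le; apply/andP; split.
  by apply: ge_sup => //; exists L.
by apply: ub_le_sup => //; exists L.
Qed.

End Perron.

(** * Symmetrization *)

Section Symmetrization.
Variables (R : realFieldType) (T : finType) (e : rel T) (p : T -> T -> R).
Hypotheses (e_sym : symmetric e) (e_irr : irreflexive e).
Hypothesis p_sym : forall u w, p u w = p w u.

(** The pairs are ordered, so [cross W W] counts every edge twice. *)
Definition cross (A B : {set T}) : R :=
  \sum_(u in A) \sum_(w in B) p u w *+ e u w.

Definition weight (g : T -> R) (W : {set T}) : R :=
  cross W W + \sum_(u in W) g u.

(* Twice the edge weight, plus the vertex weight, of the complete partite graph *)
(* that has, for each [a] in [s], a part consisting of [a.1] clones of [a.2]. *)
Definition blowup_weight (g : T -> R) (s : seq (nat * T)) : R :=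
  \sum_(a <- s) a.1%:R * g a.2
  + \sum_(a <- s) \sum_(b <- s) a.1%:R * b.1%:R * p a.2 b.2
  - \sum_(a <- s) a.1%:R ^+ 2 * p a.2 a.2.

(** The edges from the first part to the others become an additional vertex weight on the latter.
    This is why [symmetrization] is stated for an arbitrary [g]. *)
Lemma blowup_weight_cons g k v s :
  blowup_weight g ((k, v) :: s)
  = k%:R * g v + blowup_weight (fun w => g w + 2 * k%:R * p v w) s.
Proof.
rewrite /blowup_weight !big_cons /=.
under [X in _ + (_ + X) - _]eq_bigr do rewrite big_cons /=.
under [X in _ = _ + (X + _ - _)]eq_bigr do rewrite mulrDr.
rewrite !big_split /=.
have -> : \sum_(a <- s) a.1%:R * (2 * k%:R * p v a.2)
    = \sum_(a <- s) k%:R * a.1%:R * p v a.2 + \sum_(a <- s) a.1%:R * k%:R * p a.2 v.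
  by rewrite -big_split; apply: eq_bigr => a _ /=; rewrite (p_sym a.2); ring.
ring.
Qed.

Lemma crossC A B : cross A B = cross B A.
Proof.
rewrite /cross exchange_big; apply: eq_bigr => u _; apply: eq_bigr => w _.
by rewrite e_sym p_sym.
Qed.

Lemma cross_splitl (N W B : {set T}) : N \subset W ->
  cross W B = cross N B + cross (W :\: N) B.
Proof.
by move=> /setIidPr NW; rewrite /cross (big_setID N) /= NW.
Qed.

(** The marginal weights of the vertices outside [N] count the pairs among these vertices twice,
    hence the subtracted [cross]. *)
Lemma weight_split g (N W : {set T}) : N \subset W ->
  weight g W = weight g N
    + (\sum_(u in W :\: N) (g u + 2 * \sum_(w in W) p u w *+ e u w)
       - cross (W :\: N) (W :\: N)).
Proof.
move=> NW; rewrite /weight [in X in _ + X](big_setID N) /= (setIidPr NW).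
rewrite big_split /= -mulr_sumr -/(cross _ W).
rewrite (cross_splitl W NW) (crossC N W) (crossC _ W).
rewrite (cross_splitl N NW) (cross_splitl (W :\: N) NW) (crossC _ N).
ring.
Qed.

Definition clique_free_in k (W : {set T}) :=
  forall A : {set T}, A \subset W -> #|A| = k ->
  ~ {in A &, forall x y, x != y -> e x y}.

Lemma symmetrization r (W : {set T}) g :
  clique_free_in r.+1 W -> {in W &, forall u w, 0 < p u w} ->
  exists s : seq (nat * T),
    [/\ (size s <= r)%N, {in s, forall a, (0 < a.1)%N /\ a.2 \in W},
        sumn (unzip1 s) = #|W|, weight g W <= blowup_weight g s &
        weight g W = blowup_weight g s ->
        exists c : T -> nat, {in W &, forall u w, e u w = (c u != c w)} /\
          forall i, #|[set u in W | c u == i]| = nth 0%N (unzip1 s) i].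
Proof.
have Wset0 (f : T -> R) :
    weight f set0 <= blowup_weight f [::] /\
    exists c : T -> nat, {in set0 &, forall u w, e u w = (c u != c w)} /\
      forall i, #|[set u in (set0 : {set T}) | c u == i]|
        = nth 0%N (unzip1 ([::] : seq (nat * T))) i.
  split; last first.
    exists (fun=> 0%N); split=> [u w|i]; first by rewrite inE.
    rewrite nth_nil; apply/eqP; rewrite cards_eq0; apply/eqP/setP => u.
    by rewrite !inE.
  by rewrite /weight /cross /blowup_weight !big_set0 !big_nil subr0.
elim: r W g => [|r IHr] W g Wfree p_gt0.
  have -> : W = set0.
    apply/setP => x; rewrite inE; apply/negP => xW.
    apply: (Wfree [set x]); rewrite ?sub1set ?cards1 //.
    by move=> y z /set1P -> /set1P ->; rewrite eqxx.
  by have [? ?] := Wset0 g; exists [::]; split => //; rewrite cards0.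
have [->|/set0Pn[v0 v0W]] := eqVneq W set0.
  by have [? ?] := Wset0 g; exists [::]; split => //; rewrite cards0.
pose f u := g u + 2 * \sum_(w in W) p u w *+ e u w.
have [v vW vmax] : exists2 v, v \in W & forall u, u \in W -> f u <= f v.
  by case: (arg_maxP f v0W) => v vW vmax; exists v.
pose N := [set w in W | e v w]; pose V := W :\: N.
have NW : N \subset W by apply/subsetP => w; rewrite inE => /andP[].
have vV : v \in V by rewrite !inE e_irr andbF.
pose h u := g u + 2 * \sum_(w in N) p u w.
(* Clones of [v] would suffice for the inequality. Cloning a maximizer of [h], the weight of a
   vertex joined to all of [N], is what settles the equality case. *)
have [z zV zmax] : exists2 z, z \in V & forall u, u \in V -> h u <= h z.
  by case: (arg_maxP h vV) => z zV zmax; exists z.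
have zW : z \in W by move: zV; rewrite inE => /andP[].
have VW u : u \in V -> u \in W by rewrite inE => /andP[].
have NfreeV : clique_free_in r.+1 N.
  move=> A AN Ar Acl; apply: (Wfree (v |: A)).
  - by rewrite subUset sub1set vW (subset_trans AN NW).
  - rewrite cardsU1 Ar; suff -> : v \notin A by [].
    by apply/negP => /(subsetP AN); rewrite inE e_irr andbF.
  - move=> x y /setU1P[->|xA] /setU1P[->|yA]; rewrite ?eqxx //.
    + by move: (subsetP AN _ yA); rewrite inE => /andP[].
    + by move: (subsetP AN _ xA); rewrite inE e_sym => /andP[].
    + exact: Acl.
have pN : {in N &, forall u w, 0 < p u w}.
  by move=> u w uN wN; apply: p_gt0; apply: (subsetP NW).
pose g' w := g w + 2 * #|V|%:R * p z w.
have [s [s_r s_pos s_sum s_le s_eq]] := IHr N g' NfreeV pN.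
pose D := \sum_(u in V) f u - cross V V.
have WE : weight g W = weight g N + D by rewrite (weight_split _ NW).
have zE : weight g N + #|V|%:R * h z = #|V|%:R * g z + weight g' N.
  rewrite /weight /h /g' big_split /= -mulr_sumr; ring.
have q_ge0 u w : u \in V -> w \in V -> 0 <= p u w *+ e u w.
  by move=> uV wV; rewrite mulrn_wge0 // ltW // p_gt0 // VW.
have [Dle Deq] : D <= #|V|%:R * h z /\
    (D = #|V|%:R * h z ->
     {in V, forall u w, w \in W -> e u w = (w \in N)}).
  (* An edge inside [V] makes the bound strict through the subtracted [cross V V]. Without one,
     [f u <= h u <= h z] on [V], and equality forces [u] to be adjacent to all of [N]. *)
  have [/existsP[u /andP[uV /existsP[w /andP[wV uw]]]]|] :=
    boolP [exists u in V, exists w in V, e u w].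
    have : D < #|V|%:R * h z.
      have cross_gt0 : 0 < cross V V.
        have puw : 0 < p u w by rewrite p_gt0 ?VW.
        rewrite /cross (bigD1 u) //= (bigD1 w) //= uw mulr1n -addrA.
        rewrite ltr_pwDl // addr_ge0 //.
          by apply: sumr_ge0 => y /andP[yV _]; apply: q_ge0.
        apply: sumr_ge0 => x /andP[xV _]; apply: sumr_ge0 => y yV.
        exact: q_ge0.
      have fv : f v = h v.
        rewrite /f /h; congr (_ + 2 * _); rewrite (big_setID N) /= (setIidPr NW).
        rewrite [X in _ + X]big1 ?addr0 => [|y]; last first.
          by rewrite !inE negb_and => /andP[/orP[/negbTE ->|/negbTE ->]].
        by apply: eq_bigr => y; rewrite inE => /andP[_ ->].
      have : \sum_(u in V) f u <= \sum_(u in V) h z.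
        by apply: ler_sum => y yV; apply: le_trans (zmax _ vV); rewrite -fv vmax ?VW.
      rewrite sumr_const -mulr_natl /D; lra.
    by move=> lt; split=> [|eq]; [exact: ltW|rewrite eq ltxx in lt].
  rewrite negb_exists_in => /forallP Vindep.
  have VN u w : u \in V -> w \in V -> e u w = false.
    move=> uV wV; apply/negbTE; move: (Vindep u); rewrite uV negb_exists_in.
    by move=> /forallP/(_ w); rewrite wV.
  have crossV : cross V V = 0.
    rewrite /cross big1 // => u uV; rewrite big1 // => w wV.
    by rewrite VN // mulr0n.
  have fE u : u \in V -> f u = g u + 2 * \sum_(w in N) p u w *+ e u w.
    move=> uV; rewrite /f; congr (_ + 2 * _).
    rewrite (big_setID N) /= (setIidPr NW) [X in _ + X]big1 ?addr0 // => w wV.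
    by rewrite VN.
  have fh u : u \in V -> f u <= h u.
    move=> uV; rewrite fE // /h lerD2l ler_pM2l ?ltr0n //.
    apply: ler_sum => w wN; rewrite mulrb; case: ifP => // _.
    by rewrite ltW // p_gt0 ?(VW u uV) ?(subsetP NW w wN).
  have DE : #|V|%:R * h z - D = \sum_(u in V) (h z - f u).
    by rewrite /D crossV subr0 sumrB sumr_const mulr_natl.
  split.
    rewrite -subr_ge0 DE; apply: sumr_ge0 => u uV.
    by rewrite subr_ge0 (le_trans (fh _ uV)) ?zmax.
  move=> /eqP; rewrite eq_sym -subr_eq0 DE psumr_eq0; last first.
    by move=> u uV; rewrite subr_ge0 (le_trans (fh _ uV)) ?zmax.
  move=> /allP eqz u uV w wW; have := eqz u (mem_index_enum _).
  rewrite uV /= subr_eq0 => /eqP zu.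
  have [wN|wN] := boolP (w \in N); last by rewrite VN // inE wN wW.
  apply/negbNE/negP => uw.
  have : f u < h u; last by rewrite ltNge -zu zmax.
  rewrite fE // /h ltrD2l ltr_pM2l ?ltr0n //.
  rewrite [X in X < _](bigD1 w) //= [X in _ < X](bigD1 w) //=.
  rewrite (negbTE uw) mulr0n; apply: ltr_leD; first by rewrite p_gt0 ?(VW u uV).
  apply: ler_sum => y /andP[yN _]; rewrite mulrb; case: ifP => // _.
  by rewrite ltW // p_gt0 ?(VW u uV) ?(subsetP NW y yN).
have V_gt0 : (0 < #|V|)%N by apply/card_gt0P; exists v.
exists ((#|V|, z) :: s); split => //.
- by move=> a; rewrite inE => /predU1P[->//|/s_pos[? /(subsetP NW)]].
- by rewrite /= s_sum addnC -(cardsID N W) (setIidPr NW).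
- rewrite WE blowup_weight_cons; apply: le_trans (_ : #|V|%:R * g z + weight g' N <= _).
    by rewrite -zE lerD2l.
  by rewrite lerD2l.
- rewrite WE blowup_weight_cons => eqW.
  have := s_le; rewrite -(lerD2l (#|V|%:R * g z)) => s_le'.
  have DV : D = #|V|%:R * h z.
    by apply/eqP; rewrite eq_le Dle /= -(lerD2l (weight g N)) eqW zE.
  have [c [cE cN]] : exists c : T -> nat,
      {in N &, forall u w, e u w = (c u != c w)} /\
          forall i, #|[set u in N | c u == i]| = nth 0%N (unzip1 s) i.
    apply: s_eq; apply: (addrI (#|V|%:R * g z)).
    by rewrite -eqW -zE DV.
  (* Colour 0 is the new part, the head of the list; the colours of [N] are shifted accordingly. *)
  exists (fun u => if u \in N then (c u).+1 else 0%N); split.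
    move=> u w uW wW.
    have [uN|uN] := boolP (u \in N); have [wN|wN] := boolP (w \in N).
    - by rewrite cE.
    - by rewrite e_sym (Deq DV) ?uN // inE wN.
    - by rewrite (Deq DV) ?wN // inE uN.
    - by rewrite (Deq DV) ?(negbTE wN) // inE uN.
  move=> [|i] /=.
    by apply: eq_card => u; rewrite !inE; case: (u \in W); case: (e v u).
  rewrite -cN; apply: eq_card => u; rewrite !inE.
  by case: (u \in W); case: (e v u).
Qed.

End Symmetrization.

(** * The A_alpha form *)

Section Engine.
Variables (R : realType) (n : nat) (alpha : R).
Hypothesis alpha_bounds : 0 <= alpha < 1.

Lemma mulmx_alpha (G : sgraph n) (x : 'rV[R]_n) i :
  (x *m alpha_mx alpha G) 0 i
  = alpha * (degree G i)%:R * x 0 i + (1 - alpha) * \sum_j x 0 j *+ G i j.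
Proof.
rewrite /alpha_mx /deg_mx mulmxDr -!scalemxAr mul_mx_diag !mxE; congr (_ + _).
  by ring.
congr (_ * _); apply: eq_bigr => j _.
by rewrite mxE adj_sym mulr_natr.
Qed.

Lemma alpha_perron (G : sgraph n) : (0 < n)%N ->
  exists x : 'I_n -> R,
  [/\ exists i, 0 < x i, forall i, 0 <= x i &
      forall i, lambda (alpha_mx alpha G) * x i =
        alpha * (degree G i)%:R * x i + (1 - alpha) * \sum_j x j *+ G i j].
Proof.
move=> n_gt0; have [||x [x0 x_ge0 xM]] := @perron R n (alpha_mx alpha G) n_gt0.
- move=> i j; rewrite !mxE adj_sym eq_sym.
  by have [->|_] := eqVneq i j.
- move=> i j /negbTE ij; rewrite !mxE ij mulr0n mulr0 add0r mulr_ge0 //.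
  by case/andP: alpha_bounds => _ /ltW; rewrite subr_ge0.
exists (fun i => x 0 i); split=> // [|i].
  apply/existsP; apply: contraR x0 => /existsPn xle.
  apply/eqP/rowP => i; rewrite mxE; apply/eqP; rewrite eq_le x_ge0 andbT.
  by rewrite leNgt xle.
by rewrite -mulmx_alpha xM mxE.
Qed.

Definition hsum (mu : R) (s : seq nat) : R :=
  \sum_(t <- s) t%:R / (mu + t%:R).

Section Form.
Variable x : 'I_n -> R.

(** Half the contribution of an edge to the quadratic form of [alpha_mx], because [cross] counts
    edges twice. On the diagonal it equals [x u ^+ 2]. *)
Definition pair_form (u w : 'I_n) : R :=
  alpha * (x u ^+ 2 + x w ^+ 2) / 2 + (1 - alpha) * x u * x w.

Lemma blowup_formE (L : R) (s : seq (nat * 'I_n)) :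
  blowup_weight pair_form (fun u => - L * x u ^+ 2) s
  = (1 - alpha) * (\sum_(a <- s) a.1%:R * x a.2) ^+ 2
    - \sum_(a <- s) a.1%:R * x a.2 ^+ 2 *
        (L - alpha * (sumn (unzip1 s))%:R + a.1%:R).
Proof.
pose m : R := \sum_(a <- s) a.1%:R.
pose S := \sum_(a <- s) a.1%:R * x a.2.
pose Q := \sum_(a <- s) a.1%:R * x a.2 ^+ 2.
pose Q2 := \sum_(a <- s) a.1%:R ^+ 2 * x a.2 ^+ 2.
have -> : (sumn (unzip1 s))%:R = m.
  by rewrite /m sumnE big_map natr_sum.
have -> : \sum_(a <- s) a.1%:R * x a.2 ^+ 2 * (L - alpha * m + a.1%:R)
    = (L - alpha * m) * Q + Q2.
  rewrite /Q /Q2 mulr_sumr -big_split; apply: eq_bigr => a _ /=; ring.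
rewrite /blowup_weight.
have -> : \sum_(a <- s) a.1%:R * (- L * x a.2 ^+ 2) = - L * Q.
  by rewrite /Q mulr_sumr; apply: eq_bigr => a _; ring.
have -> : \sum_(a <- s) a.1%:R ^+ 2 * pair_form a.2 a.2 = Q2.
  by apply: eq_bigr => a _; rewrite /pair_form; field.
have -> : \sum_(a <- s) \sum_(b <- s) a.1%:R * b.1%:R * pair_form a.2 b.2
    = alpha * m * Q + (1 - alpha) * S ^+ 2.
  transitivity (\sum_(a <- s) (a.1%:R * x a.2 ^+ 2 * (alpha / 2 * m)
      + a.1%:R * (alpha / 2 * Q) + a.1%:R * x a.2 * ((1 - alpha) * S))).
    apply: eq_bigr => a _; rewrite /m /Q /S !mulr_sumr -!big_split.
    by apply: eq_bigr => b _; rewrite /pair_form /=; field.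
  by rewrite !big_split -!mulr_suml /= -/m -/Q -/S; field.
rewrite -/S; ring.
Qed.

(* Cauchy-Schwarz on [sum n_i x_i], weighted by [L - alpha m + n_i], written *)
(* as a sum of squares. *)
Lemma blowup_form_le0 (L : R) (s : seq (nat * 'I_n))
    (om := L - alpha * (sumn (unzip1 s))%:R) :
  {in s, forall a, [/\ (0 < a.1)%N, 0 < x a.2 & 0 < om + a.1%:R]} ->
  (1 - alpha) * hsum om (unzip1 s) <= 1 ->
  blowup_weight pair_form (fun u => - L * x u ^+ 2) s <= 0 /\
  (s != [::] ->
   blowup_weight pair_form (fun u => - L * x u ^+ 2) s = 0 ->
   (1 - alpha) * hsum om (unzip1 s) = 1).
Proof.
move=> s_pos H1; rewrite blowup_formE -/om.
set S := \sum_(a <- s) a.1%:R * x a.2; set D := \sum_(a <- s) _.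
set H := hsum _ _ in H1 *.
have S_ge0 : 0 <= S.
  rewrite /S big_seq sumr_ge0 // => a /s_pos[_ xa _].
  by rewrite mulr_ge0 // ltW.
have a1 : 0 < 1 - alpha by case/andP: alpha_bounds => _; rewrite subr_gt0.
have sq tau : 0 <= D - 2 * tau * S + tau ^+ 2 * H.
  rewrite /D /S /H /hsum big_map !mulr_sumr -sumrB -big_split /=.
  rewrite big_seq sumr_ge0 // => a /s_pos[_ _ wa].
  have -> : a.1%:R * x a.2 ^+ 2 * (om + a.1%:R) - 2 * tau * (a.1%:R * x a.2)
      + tau ^+ 2 * (a.1%:R / (om + a.1%:R))
      = a.1%:R / (om + a.1%:R) * (x a.2 * (om + a.1%:R) - tau) ^+ 2.
    by field; rewrite gt_eqF.
  by rewrite mulr_ge0 ?sqr_ge0 ?divr_ge0 // ltW.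
(* The best [tau] is [S / H]; the choice [(1 - alpha) * S] avoids the division and agrees with it in
   the critical case [(1 - alpha) * H = 1]. *)
have key : (1 - alpha) * S ^+ 2 - D
    <= (1 - alpha) * S ^+ 2 * ((1 - alpha) * H - 1).
  by have := sq ((1 - alpha) * S); lra.
have c_ge0 : 0 <= (1 - alpha) * S ^+ 2 by rewrite mulr_ge0 ?sqr_ge0 // ltW.
split; first by apply: le_trans key _; rewrite mulr_ge0_le0 // subr_le0.
move=> s0 eq0; apply/eqP; rewrite eq_le H1 /= leNgt; apply/negP => H_lt1.
have S_gt0 : 0 < S.
  rewrite lt0r S_ge0 andbT;
  case: s s0 @om @S @D @H s_pos {H1 S_ge0 sq key c_ge0 eq0 H_lt1} => // a s _.
  move=> om S D H s_pos.
  have [a1_gt0 xa _] := s_pos a (mem_head _ _).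
  rewrite gt_eqF // /S big_cons ltr_pwDl ?mulr_gt0 ?ltr0n // big_seq sumr_ge0 //.
  move=> b bs; have [_ xb _] : [/\ (0 < b.1)%N, 0 < x b.2 & 0 < om + b.1%:R].
    by apply: s_pos; rewrite inE bs orbT.
  by rewrite mulr_ge0 // ltW.
have : (1 - alpha) * S ^+ 2 * ((1 - alpha) * H - 1) < 0.
  by rewrite nmulr_llt0 ?subr_lt0 // mulr_gt0 ?exprn_gt0.
by rewrite ltNge -eq0 key.
Qed.

End Form.

(* When the support has [d] vertices too few, these are added to a part: this  *)
(* gains more than the shift of [mu] by [alpha d] costs. *)
Lemma hsum_deficit (mu : R) (d k : nat) (s : seq nat) :
  -1 < mu -> 0 < 2 * alpha + mu -> (0 < d)%N ->
  all (fun t => 0 < t)%N (k :: s) ->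
  hsum (mu + alpha * d%:R) (k :: s) < hsum mu (k + d :: s)%N.
Proof.
move=> mu1 amu d0 /= /andP[k0 s0].
have [a0 _] := andP alpha_bounds.
have d1 : (1 : R) <= d%:R by rewrite ler1n.
have k1 : (1 : R) <= k%:R by rewrite ler1n.
have ad : 0 <= alpha * d%:R by rewrite mulr_ge0.
rewrite /hsum !big_cons; apply: ltr_leD; last first.
  rewrite [X in X <= _]big_seq [X in _ <= X]big_seq; apply: ler_sum => t ts.
  have t1 : (1 : R) <= t%:R by rewrite ler1n (allP s0).
  by rewrite ler_wpM2l // lef_pV2 ?posrE; lra.
rewrite natrD ltr_pdivrMr; last lra.
rewrite mulrAC ltr_pdivlMr; last lra.
rewrite -subr_gt0.
have -> : (k%:R + d%:R) * (mu + alpha * d%:R + k%:R) - k%:R * (mu + (k%:R + d%:R))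
   = d%:R * (alpha * (k%:R + d%:R) + mu) by ring.
rewrite mulr_gt0 ?ltr0n //.
(* Since k and d are at least 1, the hypothesis [0 < 2 * alpha + mu] is enough. *)
suff : alpha * 2 <= alpha * (k%:R + d%:R) by lra.
by rewrite ler_wpM2l //; lra.
Qed.

(** The chain 0 <= [F] <= blow-up <= 0 collapses, so all equality cases hold at once: full support,
    complete partite structure, critical sizes. The bound [-1 < mu] keeps denominators positive even
    for parts of one vertex. *)
Lemma extremal_partite (r : nat) (G : sgraph n) (mu : R) :
  (0 < n)%N -> -1 < mu -> 0 < 2 * alpha + mu -> clique_free r.+1 G ->
  (forall s, all (fun t => 0 < t)%N s -> (size s <= r)%N -> sumn s = n ->
    (1 - alpha) * hsum mu s <= 1) ->
  alpha * n%:R + mu <= lambda (alpha_mx alpha G) ->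
  exists (s : seq nat) (c : 'I_n -> nat),
    [/\ all (fun t => 0 < t)%N s /\ (size s <= r)%N, sumn s = n,
        (1 - alpha) * hsum mu s = 1,
        lambda (alpha_mx alpha G) = alpha * n%:R + mu &
        (forall u w, G u w = (c u != c w)) /\
        forall i, #|[set u | c u == i]| = nth 0%N s i].
Proof.
move=> n0 mu1 amu Gfree Hle; set l := lambda _; set L := _ + mu => Ll.
have [x [[i0 xi0] x_ge0 xE]] := alpha_perron G n0.
have [a0 a1] := andP alpha_bounds.
pose W := [set u | 0 < x u].
have xW u : u \notin W -> x u = 0.
  by rewrite inE -leNgt => xu; apply/eqP; rewrite eq_le xu x_ge0.
(* Where [x] vanishes, the eigenvector equation makes a sum of nonnegative entries over the
   neighbours vanish. So no edge leaves [W], and degrees can be counted inside it. *)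
have GW u w : u \in W -> G u w -> w \in W.
  move=> uW uw; apply/negPn/negP => /xW xw0.
  move: (xE w); rewrite xw0 !mulr0 add0r => /esym/eqP.
  rewrite mulf_eq0 subr_eq0 gt_eqF //= psumr_eq0 => [/allP/(_ u (mem_index_enum _))|j _].
    by rewrite adj_sym uw mulr1n gt_eqF //; rewrite inE in uW.
  by rewrite mulrn_wge0.
have Wfree : clique_free_in G r.+1 W.
  by move=> A _ Ar Acl; apply: Gfree; exists A.
have p_gt0 : {in W &, forall u w, 0 < pair_form x u w}.
  move=> u w; rewrite !inE => xu xw; rewrite /pair_form ltr_wpDl //.
    by rewrite divr_ge0 ?mulr_ge0 ?addr_ge0 ?sqr_ge0.
  by rewrite !mulr_gt0 ?subr_gt0.
have p_sym u w : pair_form x u w = pair_form x w u by rewrite /pair_form; ring.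
have [s [s_r s_pos s_sum s_le s_eq]] := symmetrization (@adj_sym _ G)
  (@adj_irrefl _ G) p_sym (fun u => - L * x u ^+ 2) Wfree p_gt0.
set F := weight _ _ _ _ in s_le s_eq.
have FE : F = (l - L) * \sum_(u in W) x u ^+ 2.
  have -> : F = \sum_(u in W) (l * x u ^+ 2 - L * x u ^+ 2).
    rewrite /F /weight /cross sumrB -sumrN; congr (_ + _); last first.
      by apply: eq_bigr => u _; rewrite mulNr.
    transitivity (\sum_(u in W) \sum_(w in W) alpha / 2 * x u ^+ 2 *+ G u w
       + \sum_(u in W) \sum_(w in W)
           (alpha / 2 * x w ^+ 2 + (1 - alpha) * x u * x w) *+ G u w).
      rewrite -big_split; apply: eq_bigr => u _; rewrite -big_split.
      by apply: eq_bigr => w _ /=; rewrite -mulrnDl /pair_form; congr (_ *+ _); field.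
    (* Exchanging the ends of each ordered pair turns [x w ^+ 2] into [x u ^+ 2], which makes the
       degree of [u] appear. *)
    rewrite [X in _ + X = _](_ : _ = \sum_(u in W) \sum_(w in W)
           (alpha / 2 * x u ^+ 2 + (1 - alpha) * x u * x w) *+ G u w); last first.
      rewrite exchange_big; apply: eq_bigr => u _; apply: eq_bigr => w _ /=.
      by rewrite adj_sym; congr (_ *+ _); ring.
    rewrite -big_split; apply: eq_bigr => u uW; rewrite -big_split /=.
    have degE : (degree G u)%:R = \sum_(w in W) (G u w)%:R :> R.
      rewrite /degree -sum1dep_card natr_sum [LHS]big_mkcond [RHS]big_mkcond.
      apply: eq_bigr => w _; have := GW u w uW.
      by case: (G u w) => [->|_] //; case: ifP.
    have sumE : \sum_j x j *+ G u j = \sum_(w in W) x w *+ G u w.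
      rewrite [LHS](bigID (mem W)) /= [X in _ + X]big1 ?addr0 // => w wW.
      by rewrite (contraNF (GW u w uW) wW) mulr0n.
    have -> : l * x u ^+ 2 = (l * x u) * x u by ring.
    rewrite xE degE sumE [RHS]mulrDl !mulr_sumr !mulr_suml -big_split /=.
    by apply: eq_bigr => w _; case: (G u w); rewrite ?mulr1n ?mulr0n; field.
  by rewrite mulr_sumr; apply: eq_bigr => u _; rewrite mulrBl.
have i0W : i0 \in W by rewrite inE.
have X_gt0 : 0 < \sum_(u in W) x u ^+ 2.
  rewrite (bigD1 i0) //= ltr_pwDl ?exprn_gt0 //.
  by apply: sumr_ge0 => u _; apply: sqr_ge0.
have F_ge0 : 0 <= F by rewrite FE mulr_ge0 ?subr_ge0 // ltW.
have W_le : (#|W| <= n)%N by have := max_card (mem W); rewrite card_ord.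
have s_neq0 : s != [::].
  apply: contraTneq i0W => s0; move: s_sum; rewrite s0 /= => /esym/eqP.
  by rewrite cards_eq0 => /eqP ->; rewrite inE.
pose d := (n - #|W|)%N; have dE : n = (#|W| + d)%N by rewrite subnKC.
have s1_pos : all (fun t => 0 < t)%N (unzip1 s).
  by apply/allP => _ /mapP[a /s_pos[? _] ->].
have s1_r : (size (unzip1 s) <= r)%N by rewrite size_map.
(* The blow-up has only n - d vertices, which shifts mu by alpha d. *)
have omE : L - alpha * (sumn (unzip1 s))%:R = mu + alpha * d%:R.
  have nE : n%:R = #|W|%:R + d%:R :> R by rewrite -natrD -dE.
  by rewrite s_sum /L nE; ring.
have [H1 Hd] : (1 - alpha) * hsum (mu + alpha * d%:R) (unzip1 s) <= 1 /\
    ((1 - alpha) * hsum (mu + alpha * d%:R) (unzip1 s) = 1 -> d = 0%N).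
  have [d0|d_gt0] := posnP d.
    rewrite d0 mulr0 addr0; split=> //; apply: Hle => //.
    by rewrite s_sum; move: dE; rewrite d0 addn0.
  case: (unzip1 s) s_sum s1_pos s1_r => [|k s'] /= s_sum s1_pos s1_r.
    by rewrite /hsum big_nil mulr0; split=> [|/eqP]; rewrite ?ler01 // eq_sym oner_eq0.
  suff H_lt1 : (1 - alpha) * hsum (mu + alpha * d%:R) (k :: s') < 1.
    by split=> [|eq]; [exact: ltW|rewrite eq ltxx in H_lt1].
  have s2_pos : all (fun t => 0 < t)%N (k + d :: s')%N.
    by case/andP: s1_pos => k0 /= ->; rewrite addn_gt0 k0.
  have s2_sum : sumn (k + d :: s')%N = n by rewrite /= addnAC s_sum -dE.
  apply: lt_le_trans (Hle _ s2_pos s1_r s2_sum).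
  by rewrite ltr_pM2l ?subr_gt0 // hsum_deficit.
have s_pos' : {in s, forall a,
    [/\ (0 < a.1)%N, 0 < x a.2 & 0 < mu + alpha * d%:R + a.1%:R]}.
  move=> a /s_pos[a_gt0]; rewrite inE => xa; split=> //.
  have : (1 : R) <= a.1%:R by rewrite ler1n.
  have : 0 <= alpha * d%:R by rewrite mulr_ge0.
  by lra.
have := @blowup_form_le0 x L s; rewrite /= omE => /(_ s_pos' H1)[B_le0 B_eq0].
have B0 : blowup_weight (pair_form x) (fun u => - L * x u ^+ 2) s = 0.
  by apply/eqP; rewrite eq_le B_le0 (le_trans F_ge0).
have F0 : F = 0 by apply/eqP; rewrite eq_le F_ge0 -B0 s_le.
have H1' := B_eq0 s_neq0 B0; have d0 := Hd H1'.
have WT : W = [set: 'I_n].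
  by apply/eqP; rewrite eqEcard subsetT cardsT card_ord /=; move: dE; rewrite d0 addn0 => <-.
have [|c [cE cN]] := s_eq; first by rewrite F0 B0.
exists (unzip1 s), c; split.
- by [].
- by rewrite s_sum; move: dE; rewrite d0 addn0.
- by rewrite d0 mulr0 addr0 in H1'.
- move: F0; rewrite FE => /eqP.
  by rewrite mulf_eq0 (gt_eqF X_gt0) orbF subr_eq0 => /eqP.
- split=> [u w|i]; first by rewrite cE ?WT ?inE.
  by rewrite -cN; apply: eq_card => u; rewrite WT !inE.
Qed.

End Engine.

(** * Complete partite graphs *)

Lemma big_mkseq (S : Type) (idx : S) (op : S -> S -> S) (I : Type) (f : nat -> I)
    r (F : I -> S) :
  \big[op/idx]_(t <- mkseq f r) F t = \big[op/idx]_(i < r) F (f i).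
Proof.
by rewrite big_map -(big_mkord xpredT (fun i => F (f i))) /index_iota subn0.
Qed.

Section Partite.
Variables (R : realType) (n : nat).
Implicit Types (c d : 'I_n -> nat) (s : seq nat) (mu : R).

Definition class_size c (i : nat) := #|[set u | c u == i]|.

Lemma sum_class_size c r : (forall u, c u < r)%N ->
  sumn (mkseq (class_size c) r) = n.
Proof.
move=> cr; rewrite sumnE big_mkseq -[in RHS](card_ord n) -sum1_card.
rewrite (partition_big (fun u => Ordinal (cr u)) xpredT) //=.
apply: eq_bigr => i _; rewrite /class_size -sum1dep_card.
by apply: eq_bigl => u; rewrite -val_eqE.
Qed.

Lemma partite_lambda (alpha : R) (H : sgraph n) c r
    (mu := lambda (alpha_mx alpha H) - alpha * n%:R) :
  0 <= alpha < 1 -> (0 < n)%N ->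
  (forall u w, H u w = (c u != c w)) -> (forall u, c u < r)%N ->
  (forall i, (0 < class_size c i)%N -> 0 < mu + (class_size c i)%:R) /\
  (1 - alpha) * hsum mu (mkseq (class_size c) r) = 1.
Proof.
move=> a01 n0 HE cr; have [x [[u0 xu0] x_ge0 xE]] := alpha_perron a01 H n0.
have [a0 a1] := andP a01; pose S := \sum_u x u.
have S_gt0 : 0 < S.
  by rewrite /S (bigD1 u0) //= ltr_pwDl // sumr_ge0.
pose X i := \sum_(u | c u == i) x u.
(* The eigenvalue equation, summed over the [i]-th part. *)
have XE i : X i * (mu + (class_size c i)%:R)
    = (1 - alpha) * S * (class_size c i)%:R.
  have degE u : c u == i -> (degree H u)%:R = n%:R - (class_size c i)%:R :> R.
    move=> /eqP cu; apply/eqP; rewrite eq_sym subr_eq -natrD eqr_nat.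
    rewrite -[X in X == _](card_ord n) -(cardsC [set w | H u w]) eqn_add2l.
    apply/eqP; apply: eq_card => w; rewrite !inE HE cu negbK eq_sym //.
  have nbE u : c u == i -> \sum_w x w *+ H u w = S - X i.
    move=> /eqP cu; have -> : S = X i + \sum_(w | c w != i) x w.
      by rewrite /S (bigID (fun w => c w == i)).
    rewrite addrAC subrr add0r.
    rewrite [LHS](bigID (fun w => c w == i)) /= big1 ?add0r => [|w /eqP cw].
      by apply: eq_bigr => w cw; rewrite HE cu eq_sym cw.
    by rewrite HE cu cw eqxx.
  have : \sum_(u | c u == i) lambda (alpha_mx alpha H) * x u =
      \sum_(u | c u == i) (alpha * (n%:R - (class_size c i)%:R) * x u
        + (1 - alpha) * (S - X i)).
    by apply: eq_bigr => u cu; rewrite xE degE // nbE.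
  rewrite big_split /= -!mulr_sumr sumr_const -/(X i).
  rewrite -[(S - X i) *+ _]mulr_natr.
  have -> : #|[pred u | c u == i]| = class_size c i.
    by apply: eq_card => u; rewrite !inE.
  by rewrite /mu; lra.
have X_ge0 i : 0 <= X i by apply: sumr_ge0.
have mu_gt0 i : (0 < class_size c i)%N -> 0 < mu + (class_size c i)%:R.
  move=> ti; have : 0 < X i * (mu + (class_size c i)%:R).
    by rewrite XE !mulr_gt0 ?subr_gt0 ?ltr0n.
  have [X0|X0] := eqVneq (X i) 0; first by rewrite X0 mul0r ltxx.
  by rewrite pmulr_rgt0 // lt0r X0 X_ge0.
split=> //; rewrite /hsum big_mkseq.
have aS : (1 - alpha) * S != 0 by rewrite gt_eqF // mulr_gt0 ?subr_gt0.
apply: (mulfI (lt0r_neq0 S_gt0)); rewrite mulr1 mulrA (mulrC S) mulr_sumr.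
rewrite {2}/S (partition_big (fun u => Ordinal (cr u)) xpredT) //=.
apply: eq_bigr => i _.
transitivity (X i); last by apply: eq_bigl => u; rewrite -val_eqE.
have [t0|t_gt0] := posnP (class_size c i).
  rewrite t0 mul0r mulr0 /X big_pred0 // => u; apply/negbTE/negP => cu.
  by move/eqP: t0; rewrite cards_eq0 => /eqP/setP/(_ u); rewrite !inE cu.
by rewrite mulrA -XE mulfK // gt_eqF // mu_gt0.
Qed.

(** * Bounds for [hsum] in terms of the number and the sum of the part sizes *)

(** Each summand satisfies t / (mu + t) - 1 = - mu / (mu + t). Comparing [hsum] with the number of
    parts thus reveals the sign of mu. *)
Lemma hsum_size mu s : {in s, forall t, 0 < mu + t%:R} ->
  hsum mu s - (size s)%:R = - mu * \sum_(t <- s) (mu + t%:R)^-1.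
Proof.
move=> s_pos; have -> : (size s)%:R = \sum_(t <- s) 1 :> R.
  by rewrite big_const_seq count_predT iter_addr addr0.
rewrite /hsum mulr_sumr -sumrB !big_seq; apply: eq_bigr => t ts.
by field; rewrite gt_eqF // s_pos.
Qed.

Lemma hsum_inv_gt0 mu s : {in s, forall t, 0 < mu + t%:R} -> s != [::] ->
  0 < \sum_(t <- s) (mu + t%:R)^-1.
Proof.
case: s => // t s s_pos _; rewrite big_cons ltr_pwDl ?invr_gt0 ?s_pos ?mem_head //.
rewrite big_seq sumr_ge0 // => t' t's; rewrite invr_ge0 ltW // s_pos //.
by rewrite inE t's orbT.
Qed.

(** The first fraction is affine in t and agrees with t / (mu + t) at a and b: it is the chord. *)
Lemma chord_gap mu (a b t : R) : 0 < mu + a -> 0 < mu + b -> 0 < mu + t ->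
  (a * b + mu * t) / ((mu + a) * (mu + b)) - t / (mu + t)
  = mu * (t - a) * (t - b) / ((mu + a) * (mu + b) * (mu + t)).
Proof. by move=> a0 b0 t0; field; rewrite !gt_eqF. Qed.

(* [t / (mu + t)] lies below its chord through [a] and [b] outside [a, b] if *)
(* it is concave ([0 < mu]), and inside [a, b] if it is convex ([mu < 0]). *)
Lemma hsum_chord mu (a b : nat) s : 0 < mu + a%:R -> 0 < mu + b%:R ->
  {in s, forall t, 0 < mu + t%:R /\ 0 <= mu * (t%:R - a%:R) * (t%:R - b%:R)} ->
  let K := ((size s)%:R * (a%:R * b%:R) + mu * (sumn s)%:R)
             / ((mu + a%:R) * (mu + b%:R)) in
  hsum mu s <= K /\
  (hsum mu s = K <->
   {in s, forall t, mu * (t%:R - a%:R) * (t%:R - b%:R) = 0}).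
Proof.
move=> a0 b0 s_pos K.
pose gap (t : nat) : R := mu * (t%:R - a%:R) * (t%:R - b%:R)
  / ((mu + a%:R) * (mu + b%:R) * (mu + t%:R)).
have KE : K - hsum mu s = \sum_(t <- s) gap t.
  have -> : K = \sum_(t <- s) (a%:R * b%:R + mu * t%:R) / ((mu + a%:R) * (mu + b%:R)).
    rewrite /K -mulr_suml big_split /= sumnE natr_sum big_const_seq.
    by rewrite count_predT iter_addr addr0 mulr_sumr mulr_natl.
  rewrite /hsum -sumrB !big_seq; apply: eq_bigr => t ts.
  by rewrite chord_gap //; case: (s_pos t ts).
have gap_ge0 t : t \in s -> 0 <= gap t.
  by move=> /s_pos[t0 ?]; rewrite divr_ge0 // ltW // !mulr_gt0.
split; first by rewrite -subr_ge0 KE big_seq sumr_ge0.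
split=> [eqK t ts|all0]; last first.
  apply/esym/eqP; rewrite -subr_eq0 KE big_seq big1 // => t ts.
  by rewrite /gap all0 // mul0r.
move/esym/eqP: eqK; rewrite -subr_eq0 KE big_seq psumr_eq0 // => /allP/(_ t ts).
rewrite ts /= /gap mulf_eq0 invr_eq0 => /orP[/eqP //|].
by rewrite gt_eqF // !mulr_gt0 //; case: (s_pos t ts).
Qed.

(** * From part sizes to isomorphic graphs *)

(** For distinct a and b, the length and the sum determine both multiplicities by a linear system of
    determinant b - a. For a = b the lists are constant. *)
Lemma perm_two_values (a b : nat) s1 s2 :
  {in s1, forall t, t = a \/ t = b} -> {in s2, forall t, t = a \/ t = b} ->
  size s1 = size s2 -> sumn s1 = sumn s2 -> perm_eq s1 s2.
Proof.
have two s : {in s, forall t, t = a \/ t = b} -> a != b ->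
    size s = (count_mem a s + count_mem b s)%N /\
    sumn s = (count_mem a s * a + count_mem b s * b)%N.
  move=> sab ab; elim: s sab => [|t s IHs] sab //=.
  have [-> ->] : size s = (count_mem a s + count_mem b s)%N /\
    sumn s = (count_mem a s * a + count_mem b s * b)%N.
    by apply: IHs => t' t's; apply: sab; rewrite inE t's orbT.
  have [->|->] := sab t (mem_head _ _); rewrite eqxx ?(negbTE ab).
    by move: (count_mem _ s) (count_mem _ s) => x y; split=> /=; nia.
  rewrite eq_sym (negbTE ab).
  by move: (count_mem _ s) (count_mem _ s) => x y; split=> /=; nia.
have notin s t : {in s, forall t, t = a \/ t = b} -> t != a -> t != b ->
    count_mem t s = 0%N.
  move=> sab ta tb; apply/count_memPn/negP => /sab[te|te].
    by rewrite te eqxx in ta.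
  by rewrite te eqxx in tb.
move=> s1ab s2ab ss sum12; apply/allP => t _ /=; apply/eqP.
have [ab|ab] := eqVneq a b.
  have allE s : {in s, forall t, t = a \/ t = b} -> s = nseq (size s) a.
    move=> sab; apply/all_pred1P/allP => t' /sab[->|->] /=; rewrite ?eqxx //.
    by rewrite ab.
  by rewrite (allE _ s1ab) (allE _ s2ab) ss.
have [e1 e2] := two _ s1ab ab; have [e3 e4] := two _ s2ab ab.
have [cab cbb] : count_mem a s1 = count_mem a s2 /\ count_mem b s1 = count_mem b s2.
  rewrite ss e3 in e1; rewrite sum12 e4 in e2.
  move: e1 e2 ab; clear; move: (count_mem a s1) (count_mem b s1).
  by move: (count_mem a s2) (count_mem b s2) => x y z w; nia.
have [->//|ta] := eqVneq t a; have [->//|tb] := eqVneq t b.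
by rewrite !notin.
Qed.

Lemma coloring_iso (G H : sgraph n) c d s1 s2 :
  (forall u w, G u w = (c u != c w)) -> (forall u w, H u w = (d u != d w)) ->
  (forall i, class_size c i = nth 0%N s1 i) ->
  (forall i, class_size d i = nth 0%N s2 i) ->
  perm_eq s1 s2 -> giso G H.
Proof.
move=> GE HE cN dN /(perm_iotaP 0%N)[js js_perm s1E].
have js_uniq : uniq js by rewrite (perm_uniq js_perm) iota_uniq.
have ss : size s1 = size js by rewrite s1E size_map.
pose pi i := nth 0%N js i.
have c_lt u : (c u < size js)%N.
  rewrite ltnNge -ss; apply/negP => /(nth_default 0%N); rewrite -cN => /eqP.
  by rewrite cards_eq0 => /eqP/setP/(_ u); rewrite !inE eqxx.
have pi_inj u w : (pi (c u) == pi (c w)) = (c u == c w).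
  by rewrite nth_uniq.
have piE u j : (pi (c u) == j) = (j \in js) && (c u == index j js).
  have [j_js|j_js] := boolP (j \in js) => /=.
    by rewrite -[in LHS](nth_index 0%N j_js) nth_uniq // index_mem.
  by apply/negbTE; apply: contraNN j_js => /eqP <-; rewrite mem_nth.
(* After the relabelling [pi] both colourings take each value equally often, so a permutation of the
   vertices carries one to the other. *)
have cd : perm_eq [seq pi (c u) | u <- enum 'I_n] [tuple d u | u < n].
  have countE (f : 'I_n -> nat) j :
      count_mem j [seq f u | u <- enum 'I_n] = class_size f j.
    rewrite count_map -sum1_count big_enum_cond /class_size -sum1dep_card.
    exact: eq_bigl.
  have tupleE : tval [tuple d u | u < n] = [seq d u | u <- enum 'I_n].
    by rewrite -map_tnth_enum; apply: eq_map => u; rewrite tnth_mktuple.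
  apply/allP => j _; rewrite tupleE /= !countE dN; apply/eqP.
  transitivity (if j \in js then class_size c (index j js) else 0%N).
    rewrite /class_size; case: ifP => j_js.
      by apply: eq_card => u; rewrite !inE piE j_js.
    by apply/eqP; rewrite cards_eq0; apply/eqP/setP => u; rewrite !inE piE j_js.
  case: ifP => j_js.
    by rewrite cN s1E (nth_map 0%N) ?index_mem // nth_index.
  rewrite nth_default // leqNgt; apply: contraFN j_js.
  by rewrite (perm_mem js_perm) mem_iota.
have [p pE] := tuple_permP cd.
have pcd u : pi (c u) = d (p u).
  have /(congr1 (nth 0%N ^~ u)) := pE.
  rewrite (nth_map u) ?size_enum_ord // nth_ord_enum => ->.
  by rewrite (nth_map u) ?size_enum_ord // nth_ord_enum tnth_mktuple.
by exists p => u w; rewrite GE HE -!pcd pi_inj.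
Qed.

Lemma complete_partiteP r (G : sgraph n) :
  complete_partite r G <->
  exists c, [/\ forall u w, G u w = (c u != c w), forall u, (c u < r)%N &
    forall i, (i < r)%N -> (0 < class_size c i)%N].
Proof.
split=> [[P [Pr [Ppart Pin Pout]]]|[c [GE cr c_pos]]].
  have [/eqP Pcover Ptriv P0] := and3P Ppart.
  have Pb u : pblock P u \in enum P by rewrite mem_enum pblock_mem // Pcover inE.
  exists (fun u => index (pblock P u) (enum P)); split.
  - move=> u w; have uB : u \in pblock P u by rewrite mem_pblock Pcover inE.
    have wB : w \in pblock P w by rewrite mem_pblock Pcover inE.
    have uP := Pb u; have wP := Pb w; rewrite !mem_enum in uP wP.
    have [BB|BB] := eqVneq (pblock P u) (pblock P w).
      by rewrite BB eqxx; apply/negbTE/(Pin (pblock P u)); rewrite // BB.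
    rewrite (Pout _ _ uP wP BB) //; apply/esym; apply: contraNneq BB => ii.
    by rewrite -(nth_index set0 (Pb u)) ii nth_index.
  - by move=> u; rewrite -Pr cardE index_mem.
  - move=> i; rewrite -Pr cardE => i_lt.
    have BP : nth set0 (enum P) i \in P by rewrite -mem_enum mem_nth.
    have /set0Pn[u uB] : nth set0 (enum P) i != set0.
      by apply: contraNneq P0 => <-.
    apply/card_gt0P; exists u; rewrite inE (def_pblock Ptriv BP uB).
    by rewrite index_uniq // enum_uniq.
pose cl (i : 'I_r) := [set u | c u == i].
have cl_inj : injective cl.
  move=> i j ij; have /card_gt0P[u ui] := c_pos i (ltn_ord i).
  have : u \in cl i by [].
  by rewrite ij; move: ui; rewrite !inE => /eqP -> /eqP /val_inj.
exists [set cl i | i : 'I_r]; split; first by rewrite card_imset // card_ord.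
split.
- apply/and3P; split.
  + apply/eqP/setP => u; rewrite inE; apply/bigcupP.
    by exists (cl (Ordinal (cr u))); rewrite ?imset_f // inE.
  + apply/trivIsetP => _ _ /imsetP[i _ ->] /imsetP[j _ ->] ij.
    rewrite -setI_eq0; apply/eqP/setP => u; rewrite !inE.
    apply/negP => /andP[/eqP ui /eqP uj]; case/eqP: ij; congr cl.
    by apply: val_inj; rewrite /= -ui.
  + apply/imsetP => -[i _ i0]; have := c_pos i (ltn_ord i).
    by rewrite /class_size -/(cl i) -i0 cards0.
- by move=> _ /imsetP[i _ ->] u w; rewrite !inE GE => /eqP -> /eqP ->; rewrite eqxx.
- move=> _ _ /imsetP[i _ ->] /imsetP[j _ ->] ij u w.
  rewrite !inE GE => /eqP -> /eqP ->; apply: contra_neq ij => ij; congr cl.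
  exact: val_inj.
Qed.

End Partite.

(** * Comparison with the extremal graphs *)

Section Comparison.
Variables (R : realType) (n r : nat) (alpha : R).
Hypotheses (r_ge2 : (2 <= r)%N) (r_le_n : (r <= n)%N).
Hypothesis alpha_bounds : 0 <= alpha < 1.

Lemma class_size_ge (c : 'I_n -> nat) i : (forall u, c u < r)%N ->
  (r <= i)%N -> class_size c i = 0%N.
Proof.
move=> cr ri; apply/eqP; rewrite cards_eq0; apply/eqP/setP => u; rewrite !inE.
by apply/eqP => cu; move: (cr u); rewrite cu ltnNge ri.
Qed.

(** With mu taken from [H], a graph [G] doing at least as well has part sizes attaining the maximum
    of [hsum]. These are the sizes in [T] up to order, so [G] is isomorphic to [H]. *)
Lemma lambda_lt_partite (G H : sgraph n) (d : 'I_n -> nat)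
    (T := mkseq (class_size d) r)
    (mu := lambda (alpha_mx alpha H) - alpha * n%:R) :
  clique_free r.+1 G ->
  (forall u w, H u w = (d u != d w)) -> (forall u, d u < r)%N ->
  [/\ -1 < mu, 0 < 2 * alpha + mu &
      forall s, all (fun t => 0 < t)%N s -> (size s <= r)%N -> sumn s = n ->
        hsum mu s <= hsum mu T /\ (hsum mu s = hsum mu T -> perm_eq s T)] ->
  ~ giso G H ->
  lambda (alpha_mx alpha G) < lambda (alpha_mx alpha H).
Proof.
move=> Gfree HE dr [mu1 amu opt] GH; rewrite ltNge; apply/negP => HG; apply: GH.
have n0 : (0 < n)%N by apply: leq_trans r_le_n; apply: ltnW.
have [a0 a1] := andP alpha_bounds; have a1' : 0 < 1 - alpha by rewrite subr_gt0.
have [_ HT] := partite_lambda alpha_bounds n0 HE dr.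
rewrite -/mu -/T in HT.
have opt1 s : all (fun t => 0 < t)%N s -> (size s <= r)%N -> sumn s = n ->
    (1 - alpha) * hsum mu s <= 1.
  by move=> s0 sr sn; rewrite -[leRHS]HT ler_pM2l //; case: (opt s s0 sr sn).
have lamE : alpha * n%:R + mu <= lambda (alpha_mx alpha G).
  by rewrite /mu addrC subrK.
have [s [c [[s0 sr] sn Hs _ [GE cN]]]] :=
  extremal_partite alpha_bounds n0 mu1 amu Gfree opt1 lamE.
apply: (coloring_iso GE HE cN (s2 := T)).
  move=> i; have [ir|ri] := ltnP i r; first by rewrite nth_mkseq.
  by rewrite class_size_ge // nth_default // size_mkseq.
by case: (opt s s0 sr sn) => _; apply; apply: (mulfI (lt0r_neq0 a1')); rewrite Hs HT.
Qed.

(** By [hsum_size], (1 - 1/r - alpha) r = (1 - alpha) mu P with P > 0. *)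
Lemma sign_mu (mu : R) s : size s = r -> {in s, forall t, 0 < mu + t%:R} ->
  (1 - alpha) * hsum mu s = 1 ->
  (alpha < 1 - 1 / r%:R -> 0 < mu) /\ (1 - 1 / r%:R < alpha -> mu < 0) /\
  (alpha = 1 - 1 / r%:R -> mu = 0).
Proof.
move=> sr s_pos Hs; have r0 : 0 < r%:R :> R by rewrite ltr0n ltnW.
have s0 : s != [::] by apply: contraTneq r_ge2 => s0; rewrite -sr s0.
have P0 := hsum_inv_gt0 s_pos s0; have := hsum_size s_pos; rewrite sr.
set P := \sum_(t <- s) _ in P0 *; move=> HP.
have [a0 a1] := andP alpha_bounds; have a1' : 0 < 1 - alpha by rewrite subr_gt0.
have key : (1 - 1 / r%:R - alpha) * r%:R = (1 - alpha) * mu * P.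
  have -> : (1 - 1 / r%:R - alpha) * r%:R = (1 - alpha) * r%:R - 1.
    by field; rewrite gt_eqF.
  by move: Hs; rewrite -[hsum mu s](subrK r%:R) HP; lra.
split=> [a_lt|]; last split=> [a_gt|a_eq].
- have : 0 < (1 - alpha) * mu * P by rewrite -key mulr_gt0 // subr_gt0.
  by rewrite pmulr_lgt0 // pmulr_rgt0.
- have : (1 - alpha) * mu * P < 0 by rewrite -key pmulr_llt0 // subr_lt0.
  by rewrite pmulr_llt0 // pmulr_rlt0.
- move/esym/eqP: key; rewrite -a_eq subrr mul0r.
  by rewrite !mulf_eq0 (gt_eqF a1') (gt_eqF P0) orbF => /eqP.
Qed.

Lemma turan_class i : (i < r)%N ->
  class_size (fun u : 'I_n => (u %% r)%N) i = (n %/ r)%N \/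
  class_size (fun u : 'I_n => (u %% r)%N) i = (n %/ r).+1.
Proof.
move=> ir; rewrite /class_size card_residue //; have r0 := ltnW r_ge2.
have h1 : ((n + (r.-1 - i)) %/ r <= (n %/ r).+1)%N.
  have <- : ((n + r) %/ r)%N = (n %/ r).+1 by rewrite divnDr // divnn r0 addn1.
  by apply: leq_div2r; lia.
have h2 : (n %/ r <= (n + (r.-1 - i)) %/ r)%N by apply: leq_div2r; lia.
lia.
Qed.

(** Under this colouring S_{n,r-1} is complete r-partite: its first r - 1 vertices are singleton
    parts, and all the others share the last colour. *)
Lemma split_class i : (i < r)%N ->
  class_size (fun u : 'I_n => minn u r.-1) i = (if i == r.-1 then n - r.-1 else 1)%N.
Proof.
set d := fun u => _.
have one j : (j < r.-1)%N -> class_size d j = 1%N.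
  move=> jr; have jn : (j < n)%N by lia.
  rewrite -(cards1 (Ordinal jn)); apply: eq_card => u; rewrite !inE -val_eqE /= /d.
  by rewrite /minn; case: ltnP => //; lia.
have dr u : (d u < r)%N by rewrite /d gtn_min; apply/orP; right; lia.
move=> ir; case: eqP => [->|ne]; last by apply: one; lia.
have := sum_class_size dr; rewrite -{1}(prednK (ltnW r_ge2)) mkseqS sumn_rcons.
have -> : sumn (mkseq (class_size d) r.-1) = r.-1.
  rewrite sumnE big_mkseq (eq_bigr (fun=> 1%N)) => [|j _]; last exact: one.
  by rewrite sum1_card card_ord.
by move=> /(congr1 (subn^~ r.-1)); rewrite addKn.
Qed.

(** Every other entry takes at least 1 from the sum. For r parts of total n this bounds each size by
    n - r + 1. *)
Lemma mem_le_sumn s t : all (fun t => 0 < t)%N s -> t \in s ->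
  (t + (size s).-1 <= sumn s)%N.
Proof.
have size_le s' : all (fun t => 0 < t)%N s' -> (size s' <= sumn s')%N.
  by elim: s' => //= t' s' IHs /andP[t'0 /IHs]; lia.
elim: s => //= t' s IHs /andP[t'0 s0]; rewrite inE => /predU1P[->|ts].
  by rewrite leq_add2l size_le.
have size_gt0 : (0 < size s)%N by case: s ts {IHs s0}.
by have := IHs s0 ts; lia.
Qed.

Lemma natr_root2 (mu : R) (a b t : nat) : mu != 0 ->
  mu * (t%:R - a%:R) * (t%:R - b%:R) = 0 -> t = a \/ t = b.
Proof.
move=> mu0 /eqP; rewrite !mulf_eq0 (negbTE mu0) /= !subr_eq0 !eqr_nat.
by case/orP => /eqP; [left|right].
Qed.

(** * The three ranges of [alpha] *)

Lemma lambda_lt_turan (G : sgraph n) : clique_free r.+1 G ->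
  alpha < 1 - 1 / r%:R -> ~ giso G (turan r n) ->
  lambda (alpha_mx alpha G) < lambda (alpha_mx alpha (turan r n)).
Proof.
move=> Gfree a_lt; pose d (u : 'I_n) := (u %% r)%N.
have n0 : (0 < n)%N by apply: leq_trans r_le_n; apply: ltnW.
have [a0 a1] := andP alpha_bounds.
have dr u : (d u < r)%N by rewrite ltn_pmod // ltnW.
have HE u w : turan r n u w = (d u != d w) by [].
have [mu_pos HT] := partite_lambda alpha_bounds n0 HE dr.
apply: (lambda_lt_partite Gfree HE dr); move: mu_pos HT.
set mu := _ - _; set T := mkseq _ _ => mu_pos HT; clearbody mu.
have q0 : (0 < n %/ r)%N by rewrite divn_gt0 // ltnW.
have Tab : {in T, forall t, t = (n %/ r)%N \/ t = (n %/ r).+1}.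
  by move=> t /mapP[i]; rewrite mem_iota => /andP[_ ir] ->; apply: turan_class.
have T_pos : {in T, forall t, 0 < mu + t%:R}.
  move=> t tT; have t0 : (0 < t)%N by case: (Tab t tT) => ->.
  by have /mapP[i _ tE] := tT; rewrite tE in t0 *; apply: mu_pos.
have sizeT : size T = r by rewrite size_mkseq.
have [/(_ a_lt) mu0 _] := sign_mu sizeT T_pos HT.
have sumT : sumn T = n by apply: sum_class_size.
have pos (t : nat) : (0 < t)%N -> 0 < mu + t%:R by move=> t0; rewrite addr_gt0 ?ltr0n.
(* No integer lies strictly between [a] and [b], so the concave summand is below the chord at every
   admissible size, with equality only at [a] and [b]. *)
set a := (n %/ r)%N in q0 Tab; set b := a.+1 in Tab.
have ma := pos a q0; have mb : 0 < mu + b%:R by apply: pos.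
have chord s : all (fun t => 0 < t)%N s -> {in s, forall t : nat, 0 < mu + t%:R /\
    0 <= mu * (t%:R - a%:R) * (t%:R - b%:R)}.
  move=> s0 t ts; split; first exact/pos/(allP s0).
  rewrite -mulrA mulr_ge0 ?(ltW mu0) //; have [ta|ta] := leqP t a.
    by rewrite mulr_le0 // subr_le0 ler_nat // leqW.
  by rewrite mulr_ge0 // subr_ge0 ler_nat // ltnW.
have T0 : all (fun t => 0 < t)%N T by apply/allP => t /Tab[->|->].
have [_ [_ HTE]] := hsum_chord ma mb (chord _ T0).
split=> [||s s0 sr sn]; [lra|lra|].
have [Hs HsE] := hsum_chord ma mb (chord _ s0); rewrite sn in Hs HsE.
rewrite HTE ?sumT ?sizeT; last first.
  by move=> t /Tab[->|->]; rewrite subrr ?mulr0 ?mul0r.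
set Kr := _ / _; set Ks := _ / _ in Hs HsE.
(* Each missing part costs the value of the chord at 0, which is positive; so a maximizer has
   exactly r parts. *)
have KE : Kr - Ks = (r - size s)%:R * (a%:R * b%:R) / ((mu + a%:R) * (mu + b%:R)).
  by rewrite /Kr /Ks -mulrBl natrB //; congr (_ / _); ring.
have c0 : 0 < (a%:R * b%:R) / ((mu + a%:R) * (mu + b%:R)) :> R.
  by rewrite divr_gt0 ?mulr_gt0 ?ltr0n.
have KsKr : Ks <= Kr by rewrite -subr_ge0 KE -mulrA mulr_ge0 // ltW.
split; first exact: le_trans KsKr.
move=> HK; have KK : Ks = Kr by apply/eqP; rewrite eq_le KsKr -HK Hs.
have sr' : size s = r.
  move/eqP: KE; rewrite KK subrr eq_sym -mulrA mulf_eq0 (gt_eqF c0) orbF.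
  by rewrite pnatr_eq0 subn_eq0 => rs; apply/eqP; rewrite eqn_leq sr.
apply: (perm_two_values (a := a) (b := b)) => //; rewrite ?sr' ?sn //.
move=> t ts; apply: (natr_root2 (lt0r_neq0 mu0)).
by apply: (proj1 HsE) ts; rewrite HK.
Qed.

Lemma lambda_lt_split (G : sgraph n) : clique_free r.+1 G ->
  1 - 1 / r%:R < alpha -> ~ giso G (split_graph n r.-1) ->
  lambda (alpha_mx alpha G) < lambda (alpha_mx alpha (split_graph n r.-1)).
Proof.
move=> Gfree a_gt; pose d (u : 'I_n) := minn u r.-1.
have r1r : (r.-1 < r)%N by rewrite prednK // ltnW.
have r1n : (r.-1 <= n)%N by apply: leq_trans r_le_n; apply: ltnW.
have n0 : (0 < n)%N by apply: leq_trans r_le_n; apply: ltnW.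
have [a0 a1] := andP alpha_bounds.
have dr u : (d u < r)%N by rewrite /d gtn_min r1r orbT.
have HE u w : split_graph n r.-1 u w = (d u != d w).
  rewrite /= /split_rel -val_eqE /= /d /minn.
  case: (ltnP u) => ur; case: (ltnP w) => wr; rewrite ?andbT ?andbF ?eqxx //=.
  - by rewrite !neq_ltn (leq_trans ur wr) ur.
  - by rewrite !neq_ltn (leq_trans wr ur) wr !orbT.
have [mu_pos HT] := partite_lambda alpha_bounds n0 HE dr.
apply: (lambda_lt_partite Gfree HE dr); move: mu_pos HT.
set mu := _ - _; set T := mkseq _ _ => mu_pos HT; clearbody mu.
(* As r >= 2, vertex 0 is a part by itself; its positivity condition keeps the negative mu above
   -1. *)
have cl0 : class_size d 0 = 1%N by rewrite split_class ?ifN; lia.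
have mu1 : -1 < mu.
  by have := mu_pos 0%N; rewrite cl0 => /(_ isT); lra.
set N := (n - r.-1)%N; have N0 : (0 < N)%N.
  by rewrite subn_gt0 (leq_trans r1r).
have Tab : {in T, forall t, t = 1%N \/ t = N}.
  move=> t /mapP[i]; rewrite mem_iota => /andP[_ ir] ->; rewrite split_class //.
  by case: ifP; [right|left].
have pos (t : nat) : (0 < t)%N -> 0 < mu + t%:R.
  by rewrite -(ler1n R) => t1; lra.
have T0 : all (fun t => 0 < t)%N T by apply/allP => t /Tab[->|->].
have T_pos : {in T, forall t, 0 < mu + t%:R}.
  by move=> t tT; apply/pos/(allP T0).
have sizeT : size T = r by rewrite size_mkseq.
have [_ [/(_ a_gt) mu0 _]] := sign_mu sizeT T_pos HT.
have sumT : sumn T = n by apply: sum_class_size.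
have m1 := pos 1%N isT; have mN := pos N N0.
have chord s : all (fun t => 0 < t)%N s -> size s = r -> sumn s = n ->
    {in s, forall t : nat, 0 < mu + t%:R /\
      0 <= mu * (t%:R - 1%:R) * (t%:R - N%:R)}.
  move=> s0 sr sn t ts; have t0 := allP s0 t ts; split; first exact: pos.
  have tN : (t <= N)%N.
    by have := mem_le_sumn s0 ts; rewrite sr sn leq_subRL // addnC.
  by rewrite mulr_le0 ?nmulr_rle0 ?subr_ge0 ?subr_le0 ?ler_nat.
have [_ [_ HTE]] := hsum_chord m1 mN (chord _ T0 sizeT sumT).
have {}HTE := HTE _; rewrite sizeT sumT in HTE.
(* Here alpha > 1 - 1/r >= 1/2, so 2 alpha > 1 > - mu. *)
have amu : 0 < 2 * alpha + mu.
  have r2 : (2 : R) <= r%:R by rewrite ler_nat.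
  have : 1 / r%:R <= (2 : R)^-1 by rewrite div1r lef_pV2 ?posrE; lra.
  by lra.
split=> // s s0 sr sn.
have [sr'|sr'] := eqVneq (size s) r.
  have [Hs HsE] := hsum_chord m1 mN (chord _ s0 sr' sn).
  rewrite sr' sn in Hs HsE; rewrite HTE; last first.
    by move=> t /Tab[->|->]; rewrite subrr ?mulr0 ?mul0r.
  split=> // HK; apply: (perm_two_values (a := 1%N) (b := N)) => //.
  - by move=> t ts; apply: (natr_root2 (ltr0_neq0 mu0)); apply: (proj1 HsE) ts.
  - by rewrite sr'.
  - by rewrite sn.
(* With fewer than r parts a size may exceed [N], where the chord is no upper bound. Since mu < 0,
   each summand is at most its value at t = 1, and at most r - 1 of these fall short of [hsum mu T]
   by at least the term of the large part. *)
suff lt : hsum mu s < hsum mu T by split=> [|eq]; [exact: ltW|rewrite eq ltxx in lt].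
have h1 (t : nat) : (0 < t)%N -> t%:R / (mu + t%:R) <= (mu + 1)^-1.
  move=> t0; rewrite ler_pdivrMr ?pos // mulrC ler_pdivlMr //.
  have : mu * t%:R <= mu * 1 by rewrite ler_nM2l // ler1n.
  by lra.
have Hs : hsum mu s <= (size s)%:R / (mu + 1).
  have -> : (size s)%:R / (mu + 1) = \sum_(t <- s) (mu + 1)^-1.
    by rewrite big_const_seq count_predT iter_addr addr0 mulr_natl.
  by rewrite /hsum !big_seq; apply: ler_sum => t ts; apply/h1/(allP s0).
have HT' : hsum mu T = r.-1%:R / (mu + 1) + N%:R / (mu + N%:R).
  have -> : T = rcons (mkseq (class_size d) r.-1) (class_size d r.-1).
    by rewrite /T -{1}(prednK (ltnW r_ge2)) mkseqS.
  rewrite /hsum big_rcons /=.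
  rewrite big_mkseq split_class // eqxx.
  congr (_ + _); rewrite (eq_bigr (fun=> (mu + 1)^-1)) => [|i _].
    by rewrite sumr_const card_ord mulr_natl.
  have ir := ltn_ord i.
  by rewrite split_class ?(ltn_trans ir) // ltn_eqF // div1r.
rewrite HT'; apply: le_lt_trans Hs _; apply: le_lt_trans (_ : r.-1%:R / (mu + 1) < _).
  by rewrite ler_pM2r ?invr_gt0 // ler_nat -ltnS prednK ?(ltnW r_ge2) // ltn_neqAle sr'.
by rewrite ltrDl divr_gt0 ?ltr0n.
Qed.

(** Now mu = 0 and every summand of [hsum] is 1, so the condition on the part sizes only says that
    there are at most r of them. Any r parts are critical, whatever their sizes. *)
Lemma lambda_le_critical (G : sgraph n) : clique_free r.+1 G ->
  alpha = 1 - 1 / r%:R ->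
  lambda (alpha_mx alpha G) <= (1 - 1 / r%:R) * n%:R /\
  (lambda (alpha_mx alpha G) = (1 - 1 / r%:R) * n%:R <-> complete_partite r G).
Proof.
move=> Gfree aE; rewrite -aE.
have n0 : (0 < n)%N by apply: leq_trans r_le_n; apply: ltnW.
have r0 : 0 < r%:R :> R by rewrite ltr0n ltnW.
have hsum0 s : all (fun t => 0 < t)%N s -> hsum 0 s = (size s)%:R :> R.
  move=> s0; apply/eqP; rewrite -subr_eq0 hsum_size ?oppr0 ?mul0r //.
  by move=> t ts; rewrite add0r ltr0n (allP s0).
have cE : 1 - alpha = r%:R^-1 by rewrite aE div1r subKr.
have opt s : all (fun t => 0 < t)%N s -> (size s <= r)%N -> sumn s = n ->
    (1 - alpha) * hsum 0 s <= 1.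
  by move=> s0 sr _; rewrite hsum0 // cE ler_pdivrMl // mulr1 ler_nat.
have amu : 0 < 2 * alpha + 0.
  have r2 : (2 : R) <= r%:R by rewrite ler_nat.
  have : 1 / r%:R <= (2 : R)^-1 by rewrite div1r lef_pV2 ?posrE; lra.
  by rewrite aE; lra.
have ext : alpha * n%:R <= lambda (alpha_mx alpha G) ->
    lambda (alpha_mx alpha G) = alpha * n%:R /\ complete_partite r G.
  move=> le; have le0 : alpha * n%:R + 0 <= lambda (alpha_mx alpha G) by rewrite addr0.
  have [s [c [[s0 sr] sn Hs lE [GE cN]]]] :=
    extremal_partite alpha_bounds n0 (ltrN10 R) amu Gfree opt le0.
  split; first by rewrite lE addr0.
  have sr' : size s = r.
    move: Hs; rewrite hsum0 // cE => /(congr1 ( *%R r%:R)).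
    by rewrite mulrA mulfV ?gt_eqF // mul1r mulr1 => /eqP; rewrite eqr_nat => /eqP.
  apply/complete_partiteP; exists c; split=> // [u|i ir].
    rewrite ltnNge -sr'; apply/negP => /(nth_default 0%N); rewrite -cN => /eqP.
    by rewrite cards_eq0 => /eqP/setP/(_ u); rewrite !inE eqxx.
  by rewrite /class_size cN (allP s0) // mem_nth // sr'.
split.
  by rewrite leNgt; apply/negP => lt; case: (ext (ltW lt)) => eq; rewrite eq ltxx in lt.
split=> [eq|/complete_partiteP[c [GE cr c_pos]]].
  by case: ext => //; rewrite eq.
have [mu_pos HT] := partite_lambda alpha_bounds n0 GE cr.
have [||_ [_ /(_ aE) /eqP]] := sign_mu _ _ HT; last by rewrite subr_eq0 => /eqP.
  by rewrite size_mkseq.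
by move=> t /mapP[i]; rewrite mem_iota => /andP[_ ir] ->; apply/mu_pos/c_pos.
Qed.

End Comparison.

Theorem theorem27 (R : realType) (r n : nat) (G : sgraph n) (alpha : R)
    (hr : (2 <= r)%N) (hn : (r <= n)%N) (hG : clique_free r.+1 G) :
  [/\ 0 <= alpha < 1 - 1 / r%:R ->
        ~ giso G (turan r n) ->
        lambda (alpha_mx alpha G) < lambda (alpha_mx alpha (turan r n)),
      1 - 1 / r%:R < alpha < 1 ->
        ~ giso G (split_graph n r.-1) ->
        lambda (alpha_mx alpha G)
          < lambda (alpha_mx alpha (split_graph n r.-1)) &
      alpha = 1 - 1 / r%:R ->
        lambda (alpha_mx alpha G) <= (1 - 1 / r%:R) * n%:R /\
        (lambda (alpha_mx alpha G) = (1 - 1 / r%:R) * n%:R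
           <-> complete_partite r G)].
Proof.
have r0 : 0 < 1 / r%:R :> R by rewrite div1r invr_gt0 ltr0n ltnW.
have r1 : 1 / r%:R <= 1 :> R by rewrite div1r invf_le1 ?ltr0n ?ler1n ltnW.
split=> [/andP[a0 a1]|/andP[a0 a1]|aE].
- by apply: lambda_lt_turan => //; lra.
- by apply: lambda_lt_split => //; lra.
- by apply: lambda_le_critical => //; lra.
Qed.
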